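(* Let $d\ge 1$, $k=2^{d-1}$, and let a Treeplication multiset for $T_d$ be given, of total weight $n$. Then the output of the algorithm described in the context, run on this multiset, is a diagonal cover of $T_d$ that is an $l$-principal diagonal cover for every $l$ (with $0\le l\le n$).
   Context: $T_d$ is the perfect binary tree with $d$ layers, numbered from the leaves (layer $1$) to the root (layer $d$); $(i,j)$ denotes the $j$-th vertex from the left in layer $i$, $1\le j\le 2^{d-i}$, so the children of $(i,\ell)$ for $i\ge2$ are $(i-1,2\ell-1)$ and $(i-1,2\ell)$. A Treeplication multiset for $T_d$ is a multiset of vertices of $T_d$; the weight of a vertex is its multiplicity in the multiset, the weight of a set of vertices is the sum of their weights, and the multiset weight $n$ is the total number of elements counted with multiplicity. A diagonal is a set of vertices forming a downward path starting at an arbitrary vertex and ending at a leaf (a single leaf is allowed). A diagonal cover is a decomposition of the vertex set of $T_d$ into a disjoint union of diagonals (there are then exactly $k$ diagonals). Loss of $l$ elements: $l$ elements of the multiset are removed, chosen uniformly at random without replacement. A diagonal is non-empty after the loss if at least one remaining multiset element is a vertex of that diagonal. A diagonal cover is an $l$-principal diagonal cover if, among all diagonal covers of $T_d$, it maximizes the average over its $k$ diagonals of the probability that the diagonal is non-empty after the loss of $l$ elements. Algorithm: initialize $g_j=\{(1,j)\}$ for $j=1,\ldots,k$. For $i=2,\ldots,d$ and, for each $i$, for $\ell=1,\ldots,2^{d-i}$: let $y$ be the index with $(i-1,2\ell-1)\in g_y$ and $z$ the index with $(i-1,2\ell)\in g_z$; let $w_y,w_z$ be the current weights of $g_y,g_z$;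 if $w_y<w_z$, add $(i,\ell)$ to $g_y$, otherwise add $(i,\ell)$ to $g_z$. Output $\{g_1,\ldots,g_k\}$. *)

(* Defs.v *)
From HB Require Import structures.
From mathcomp Require Import all_boot all_order all_algebra.
From mathcomp Require Import finmap multiset.

Set Implicit Arguments.
Unset Strict Implicit.
Unset Printing Implicit Defensive.

Local Open Scope mset_scope.
Local Open Scope nat_scope.

(* Layers and positions are numbered from 1, layer 1 being the leaves. *)
Definition layer_coords (d i : nat) : seq (nat * nat) :=
  [seq (i, j) | j <- iota 1 (2 ^ (d - i))].

Definition tree_coords (d : nat) : seq (nat * nat) :=
  flatten [seq layer_coords d i | i <- iota 1 d].

Definition vertex (d : nat) : finType := seq_sub (tree_coords d).

(* Position (0, _) is not in the tree, so leaves have no children. *)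
Definition left_child d (v u : vertex d) : bool :=
  val u == ((val v).1.-1, (2 * (val v).2).-1).

Definition right_child d (v u : vertex d) : bool :=
  val u == ((val v).1.-1, 2 * (val v).2).

Definition child d (v u : vertex d) : bool := left_child v u || right_child v u.

Definition leaf d (v : vertex d) : bool := (val v).1 == 1.

Definition diagonal d (D : {set vertex d}) : Prop :=
  exists x : vertex d, exists p : seq (vertex d),
    [/\ path (@child d) x p, leaf (last x p) & D = [set v in x :: p]].

Definition diagonal_cover d (P : {set {set vertex d}}) : Prop :=
  partition P [set: vertex d] /\ (forall D, D \in P -> diagonal D).

Definition weight d (m : {mset vertex d}) (A : {set vertex d}) : nat :=
  \sum_(v in A) m v.

(* The elements of the multiset, equal ones being told apart by an index. *)
Definition element d (m : {mset vertex d}) : finType := {v : vertex d & 'I_(m v)}.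

Definition losses d (m : {mset vertex d}) (l : nat) : {set {set element m}} :=
  [set S : {set element m} | #|S| == l].

Definition nonempty_after d (m : {mset vertex d}) (D : {set vertex d})
    (S : {set element m}) : bool :=
  [exists e, (e \notin S) && (tag e \in D)].

Definition prob_nonempty d (m : {mset vertex d}) (l : nat) (D : {set vertex d}) : rat :=
  (#|[set S in losses m l | nonempty_after D S]|%:R / #|losses m l|%:R)%R.

Definition average_nonempty d (m : {mset vertex d}) (l : nat)
    (P : {set {set vertex d}}) : rat :=
  ((\sum_(D in P) prob_nonempty m l D) / #|P|%:R)%R.

Definition principal_cover d (m : {mset vertex d}) (l : nat)
    (P : {set {set vertex d}}) : Prop :=
  diagonal_cover P /\
  (forall Q, diagonal_cover Q ->
     (average_nonempty m l Q <= average_nonempty m l P)%R).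

Definition layer (d i : nat) : seq (vertex d) := pmap insub (layer_coords d i).

Definition greedy_init (d : nat) : seq {set vertex d} :=
  [seq [set v] | v <- layer d 1].

Definition greedy_step d (m : {mset vertex d}) (g : seq {set vertex d})
    (v : vertex d) : seq {set vertex d} :=
  let y := find (fun A : {set vertex d} => [exists u in A, left_child v u]) g in
  let z := find (fun A : {set vertex d} => [exists u in A, right_child v u]) g in
  let x := if weight m (nth set0 g y) < weight m (nth set0 g z) then y else z in
  set_nth set0 g x (v |: nth set0 g x).

Definition greedy d (m : {mset vertex d}) : seq {set vertex d} :=
  foldl (greedy_step m) (greedy_init d) (flatten [seq layer d i | i <- iota 2 d.-1]).

Definition greedy_output d (m : {mset vertex d}) : {set {set vertex d}} :=
  [set A in greedy m].

(* Main.v *)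
(* A diagonal ending at leaf [u] consists of the first [t u] ancestors of [u], so
   a cover is a height function [t] with every vertex reached by exactly one leaf.
   A diagonal of weight [w] is emptied by ['C(n - w, n - l)] of the losses, and
   this is convex in [w]; hence it suffices that the greedy cover minimizes the
   sum of [h (weight D)] for every convex [h]. This follows by induction on
   subtrees, with an arbitrary extra weight [x] on the diagonal through the root:
   that diagonal continues into one child, which receives the extra weight, while
   the other child receives none. If a cover continues into the child whose greedy
   diagonal is the heavier one, weight [a >= b], switching children replaces
   [h (a + y) + h b] by [h (b + y) + h a], which is no larger by convexity. *)

Require Import Defs.
From mathcomp Require Import all_boot all_order all_algebra.
From mathcomp Require Import finmap multiset.
From mathcomp Require Import zify.

Local Open Scope mset_scope.
Local Open Scope nat_scope.

(** * Convexity of the number of emptying losses *)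

Definition convex (h : nat -> nat) : Prop :=
  forall a b x, b <= a -> h (b + x) + h a <= h (a + x) + h b.

(** For [w < n] and [r > 0], Pascal's rule gives the drop from [w] to [w + 1] as
    ['C(n - w - 1, r - 1)], which does not increase with [w]. *)
Lemma convex_bin_sub n r : convex (fun w => 'C(n - w, r)).
Proof.
have inc w x : w <= x ->
    'C(n - w, r) + 'C(n - x.+1, r) >= 'C(n - w.+1, r) + 'C(n - x, r).
  (* From [n] on, truncated subtraction makes the cost constant. *)
  move=> le_wx; case: (leqP n x) => [le_nx|lt_xn].
    have -> : n - x.+1 = n - x by lia.
    by rewrite leq_add2r leq_bin2l // leq_sub2l.
  have -> : n - w = (n - w.+1).+1 by lia.
  have -> : n - x = (n - x.+1).+1 by lia.
  case: r => [|r]; first by rewrite !bin0.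
  have le_bin : 'C(n - x.+1, r) <= 'C(n - w.+1, r) by rewrite leq_bin2l // leq_sub2l.
  by rewrite !binS; lia.
move=> a b x le_ba; elim: x => [|x IH]; first by rewrite !addn0 addnC.
have := inc (b + x) (a + x) ltac:(lia); rewrite !addnS; lia.
Qed.

(** * Height functions and the exchange argument *)

(* [t u] is the number of vertices of the diagonal ending at leaf [u]; leaves
   and layers are counted from 0, so the ancestor of [u] in layer [i] sits at
   position [u %/ 2 ^ i]. *)
Definition covering (d : nat) (t : 'I_(2 ^ (d - 1)) -> nat) : Prop :=
  [/\ forall u, t u <= d,
      forall i j, i < d -> j < 2 ^ (d - i.+1) ->
        exists2 u : 'I_(2 ^ (d - 1)), u %/ 2 ^ i = j & i < t u &
      forall i (u u' : 'I_(2 ^ (d - 1))), u %/ 2 ^ i = u' %/ 2 ^ i ->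
        i < t u -> i < t u' -> u = u'].

Lemma covering_gt0 d (t : 'I_(2 ^ (d - 1)) -> nat) u :
  0 < d -> covering d t -> 0 < t u.
Proof.
move=> hd [_ t_ex _]; have [|v] := t_ex 0 u hd; first exact: ltn_ord.
by rewrite divn1 => /val_inj ->.
Qed.

(** [A u k] stands for the weight of the first [k] vertices on the way up from leaf [u]. The
    diagonal that takes an inner vertex must have been, before taking it, no heavier than any
    diagonal arriving from below. *)
Definition greedy_heights (K : nat) (A : nat -> nat -> nat) (t : 'I_K -> nat) :=
  forall i (u u' : 'I_K), u %/ 2 ^ i.+1 = u' %/ 2 ^ i.+1 ->
    i.+1 < t u -> i < t u' -> A u i.+1 <= A u' i.+1.

(* Total cost of the diagonals restricted to the subtree below vertex [j] of
   layer [i], the one through its root being given the extra weight [x]. *)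
Definition block_cost (K : nat) (h : nat -> nat) (A : nat -> nat -> nat)
    (t : 'I_K -> nat) (i j x : nat) : nat :=
  \sum_(u < K | u %/ 2 ^ i == j) h (A u (minn (t u) i.+1) + (i < t u) * x).

Lemma divn_expS u i : u %/ 2 ^ i.+1 = (u %/ 2 ^ i) %/ 2.
Proof. by rewrite expnSr divnMA. Qed.

(** The leaves below a vertex are divided between its two children. The vertex lies on the diagonal
    of [u], so its own weight and [x] pass as extra weight to the child on that side; the sibling
    [b] gets none. *)
Lemma block_cost_split d h A W (t : 'I_(2 ^ (d - 1)) -> nat)
    (u : 'I_(2 ^ (d - 1))) i b x :
  (forall v k, A v k.+1 = A v k + W k (v %/ 2 ^ k)) ->
  covering d t -> i.+1 < t u ->
  b %/ 2 = u %/ 2 ^ i.+1 -> b != u %/ 2 ^ i ->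
  block_cost _ h A t i.+1 (u %/ 2 ^ i.+1) x =
  block_cost _ h A t i (u %/ 2 ^ i) (W i.+1 (u %/ 2 ^ i.+1) + x) +
  block_cost _ h A t i b 0.
Proof.
move=> AS [_ _ t_uniq] tu b2 neq_b.
rewrite /block_cost (bigID (fun v : 'I__ => v %/ 2 ^ i == u %/ 2 ^ i)) /=.
congr (_ + _).
  apply: eq_big => [v|v /andP[/eqP eqS /eqP eqi]].
    rewrite !divn_expS; apply/andP/eqP => [[_ /eqP]|->] //.
  case: (eqVneq v u) => [->|neq_vu].
    rewrite tu (ltnW tu) !mul1n (minn_idPr _) // (minn_idPr _) 1?ltnW //.
    by rewrite AS addnA.
  have tv : t v <= i.
    by rewrite leqNgt; apply: contraNN neq_vu => tv; rewrite (t_uniq i v u) // ltnW.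
  by congr (h (A _ _ + _)); move: tv; lia.
apply: eq_big => [v|v /andP[/eqP eqS neqi]].
  rewrite !divn_expS in b2 *; lia.
have tv : t v <= i.+1.
  rewrite leqNgt; apply: contraNN neqi => tv.
  by rewrite (t_uniq i.+1 v u).
by congr (h (A _ _ + _)); move: tv; lia.
Qed.

(** Only the diagonal through the root feels [x]; isolating it leaves a single value of [h] to which
    convexity applies. *)
Lemma block_cost_root d h A (t : 'I_(2 ^ (d - 1)) -> nat) (u : 'I_(2 ^ (d - 1))) i :
  covering d t -> i < t u ->
  exists c, forall x,
    block_cost _ h A t i (u %/ 2 ^ i) x = h (A u i.+1 + x) + c.
Proof.
move=> [_ _ t_uniq] tu.
exists (\sum_(v < 2 ^ (d - 1) | (v %/ 2 ^ i == u %/ 2 ^ i) && (v != u))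
  h (A v (minn (t v) i.+1))) => x.
rewrite /block_cost (bigD1 u) //= tu mul1n (minn_idPr _) //; congr (_ + _).
apply: eq_bigr => v /andP[/eqP eqi neq_vu].
have -> : i < t v = false.
  by apply: contraNF neq_vu => tv; rewrite (t_uniq i v u).
by rewrite addn0.
Qed.

(** The induction on layers is for all [x] at once, since the extra weight changes on passing to a
    child. *)
Lemma block_cost_greedy_le d h A W (t t' : 'I_(2 ^ (d - 1)) -> nat) i j x :
  (forall v k, A v k.+1 = A v k + W k (v %/ 2 ^ k)) -> convex h ->
  covering d t -> greedy_heights _ A t -> covering d t' ->
  i < d -> j < 2 ^ (d - i.+1) ->
  block_cost _ h A t i j x <= block_cost _ h A t' i j x.
Proof.
move=> AS h_convex ct gt ct'; elim: i j x => [|i IH] j x lt_id lt_j.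
  apply: leq_sum => u _.
  have tu := covering_gt0 d t u lt_id ct; have tu' := covering_gt0 d t' u lt_id ct'.
  by rewrite tu tu' !(minn_idPr _).
have [_ t_ex _] := ct; have [_ t_ex' _] := ct'.
have [u uj tu] := t_ex _ _ lt_id lt_j.
have [u' uj' tu'] := t_ex' _ _ lt_id lt_j.
have lt_child b : b %/ 2 = j -> b < 2 ^ (d - i.+1).
  have -> : d - i.+1 = (d - i.+2).+1 by lia.
  by move=> b2; rewrite expnS; lia.
have lt_i : i < d by lia.
have sib (a : nat) : exists2 b, b %/ 2 = a %/ 2 & b != a.
  by exists (if odd a then a.-1 else a.+1); case: ifP; lia.
have ua : u %/ 2 ^ i %/ 2 = j by rewrite -divn_expS.
have ua' : u' %/ 2 ^ i %/ 2 = j by rewrite -divn_expS.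
have [eq_a|neq_a] := eqVneq (u %/ 2 ^ i) (u' %/ 2 ^ i).
  have [b b2 neq_b] := sib (u %/ 2 ^ i).
  rewrite -{1}uj (block_cost_split d h A W t u i b) // ?divn_expS //.
  rewrite -{1}uj' (block_cost_split d h A W t' u' i b) // ?divn_expS -?eq_a //.
  by rewrite ua; apply: leq_add; apply: IH => //; apply: lt_child => //; lia.
rewrite -{1}uj (block_cost_split d h A W t u i (u' %/ 2 ^ i)) //; last first.
- by rewrite eq_sym.
- by rewrite divn_expS ua ua'.
rewrite -{1}uj' (block_cost_split d h A W t' u' i (u %/ 2 ^ i)) //; last first.
  by rewrite divn_expS ua ua'.
rewrite uj uj'; set y := _ + x.
(* The induction hypothesis makes both child blocks greedy while [y] stays on the child chosen by
   [t']; it remains to move [y] to the child chosen by [t]. Below, [v] is the leaf whose greedy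
   diagonal contains the former child. *)
apply: leq_trans (leq_add (IH _ y lt_i (lt_child _ ua')) (IH _ 0 lt_i (lt_child _ ua))).
have [v vi tv] := t_ex i (u' %/ 2 ^ i) lt_i (lt_child _ ua').
rewrite -vi; have [c Ec] := block_cost_root d h A t u i ct (ltnW tu).
have [c' Ec'] := block_cost_root d h A t v i ct tv.
have le_uv : A u i.+1 <= A v i.+1.
  by apply: gt => //; rewrite !divn_expS ua vi ua'.
have := h_convex _ _ y le_uv; rewrite !Ec !Ec' !addn0; lia.
Qed.

Lemma greedy_heights_optimal d h A W (t t' : 'I_(2 ^ (d - 1)) -> nat) :
  0 < d ->
  (forall v k, A v k.+1 = A v k + W k (v %/ 2 ^ k)) -> convex h ->
  covering d t -> greedy_heights _ A t -> covering d t' ->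
  \sum_(u < 2 ^ (d - 1)) h (A u (t u)) <=
  \sum_(u < 2 ^ (d - 1)) h (A u (t' u)).
Proof.
move=> hd AS h_convex ct gt ct'.
have total s : covering d s -> \sum_(u < 2 ^ (d - 1)) h (A u (s u)) =
      block_cost _ h A s (d - 1) 0 0.
  move=> [s_le _ _]; apply: eq_big => [u|u _].
    by rewrite divn_small.
  by have := s_le u => le_s; rewrite muln0 addn0 (minn_idPl _) //; lia.
rewrite !total //.
apply: (block_cost_greedy_le d h A W) => //; first by lia.
by rewrite expn_gt0.
Qed.

(** * Diagonals in coordinates *)

Lemma mem_tree_coords d c :
  (c \in tree_coords d) = (0 < c.1 <= d) && (0 < c.2 <= 2 ^ (d - c.1)).
Proof.
apply/flatten_mapP/andP => [[i]|[c1 c2]].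
  by rewrite mem_iota => ? /mapP[j]; rewrite mem_iota => ? -> /=; lia.
exists c.1; first by rewrite mem_iota; lia.
apply/mapP; exists c.2; last by case: c c1 c2.
by rewrite mem_iota; lia.
Qed.

Lemma vertex_bounds d (v : vertex d) :
  (0 < (val v).1 <= d) && (0 < (val v).2 <= 2 ^ (d - (val v).1)).
Proof. by rewrite -mem_tree_coords; apply: (valP v). Qed.

Lemma vertex_at d i j : i < d -> j < 2 ^ (d - i.+1) ->
  exists v : vertex d, val v = (i.+1, j.+1).
Proof.
move=> lt_id lt_j; have mem_c : (i.+1, j.+1) \in tree_coords d.
  by rewrite mem_tree_coords /= lt_id lt_j.
by exists (SeqSub mem_c).
Qed.

Lemma ancestor_lt d i (u : 'I_(2 ^ (d - 1))) : i < d -> u %/ 2 ^ i < 2 ^ (d - i.+1).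
Proof.
move=> lt_id; rewrite ltn_divLR ?expn_gt0 // -expnD.
by have -> : d - i.+1 + i = d - 1 by lia.
Qed.

(** The lowest [t] vertices above leaf [u], the leaf included. Coordinates start at 1, but [u] and
    the layers of a height function at 0, hence the predecessors. *)
Definition stem (d u t : nat) : {set vertex d} :=
  [set v | ((val v).1 <= t) && ((val v).2.-1 == u %/ 2 ^ (val v).1.-1)].

Lemma mem_stem d u t (v : vertex d) i j : val v = (i.+1, j.+1) ->
  (v \in stem d u t) = (i < t) && (u %/ 2 ^ i == j).
Proof. by move=> Ev; rewrite inE Ev /= eq_sym. Qed.

Lemma vertexP d (v : vertex d) :
  exists i j, [/\ val v = (i.+1, j.+1), i < d & j < 2 ^ (d - i.+1)].
Proof.
have := vertex_bounds d v; case: (val v) => [[|i] [|j]] //= /andP[]; try lia.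
by exists i, j.
Qed.

Lemma stemS d u t (v : vertex d) : val v = (t.+1, (u %/ 2 ^ t).+1) ->
  stem d u t.+1 = v |: stem d u t.
Proof.
move=> Ev; apply/setP => w; have [i [j [Ew _ _]]] := vertexP d w.
rewrite in_setU1 !(mem_stem d u _ w i j Ew) -(inj_eq val_inj) Ew Ev xpair_eqE !eqSS.
rewrite ltnS leq_eqVlt; case: (eqVneq i t) => [->|_] /=; last by [].
by rewrite ltnn orbF eq_sym.
Qed.

Lemma stem1 d u (v : vertex d) : val v = (1, u.+1) -> stem d u 1 = [set v].
Proof.
move=> Ev; rewrite (stemS d u 0 v) ?divn1 //; apply/setP => w.
have [i [j [Ew _ _]]] := vertexP d w.
by rewrite in_setU1 (mem_stem d u 0 w i j Ew) inE orbF.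
Qed.

(** The sum has at most one term and is empty above the root, so the recurrence needs no bound on
    [t]. *)
Lemma weight_stemS d (m : {mset vertex d}) u t :
  weight m (stem d u t.+1) =
  weight m (stem d u t) + \sum_(v : vertex d | val v == (t.+1, (u %/ 2 ^ t).+1)) m v.
Proof.
rewrite /weight (bigID (fun v => v \in stem d u t)) /=; congr (_ + _).
  apply: eq_bigl => v; have [i [j [Ev _ _]]] := vertexP d v.
  by rewrite !(mem_stem d u _ v i j Ev); lia.
apply: eq_bigl => v; have [i [j [Ev _ _]]] := vertexP d v.
rewrite !(mem_stem d u _ v i j Ev) Ev xpair_eqE !eqSS.
by case: (eqVneq i t) => [->|] /=; lia.
Qed.

(** The path is rebuilt from its end: the last vertex is the leaf [u], and each vertex put in front
    is the next ancestor of [u]. *)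
Lemma diagonal_stem d (D : {set vertex d}) : diagonal D ->
  exists u : 'I_(2 ^ (d - 1)), exists2 t, 0 < t <= d & D = stem d u t.
Proof.
move=> [x [p [path_p leaf_p ->]]] {D}.
suff [u [t [t_d Ex E]]] : exists u : 'I_(2 ^ (d - 1)), exists t,
  [/\ t < d, val x = (t.+1, (u %/ 2 ^ t).+1) & [set v in x :: p] = stem d u t.+1].
  by exists u, t.+1; rewrite ?E.
elim: p x path_p leaf_p => [|y p IH] x /=.
  move=> _; rewrite /leaf; have [i [j [Ex lt_i lt_j]]] := vertexP d x.
  rewrite Ex /= eqSS => /eqP i0; rewrite {i}i0 in Ex lt_i lt_j.
  exists (Ordinal lt_j), 0; split=> //=; first by rewrite divn1.
  by rewrite (stem1 d j x Ex); apply/setP => v; rewrite !inE.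
move=> /andP[child_xy path_p] leaf_p.
have [u [t [t_d Ey E]]] := IH _ path_p leaf_p.
have [i [j [Ex lt_i lt_j]]] := vertexP d x.
have [Ei Ej] : i = t.+1 /\ j = u %/ 2 ^ t.+1.
  rewrite divn_expS; move: child_xy; rewrite /child /left_child /right_child Ex Ey.
  by rewrite !xpair_eqE /=; lia.
rewrite Ei Ej in Ex lt_i; exists u, t.+1; split=> //.
rewrite (stemS d u t.+1 x) // -E; apply/setP => v.
by rewrite !inE.
Qed.

Lemma stem_diagonal d (u : 'I_(2 ^ (d - 1))) t : 0 < t <= d ->
  diagonal (stem d u t).
Proof.
case: t => //= t lt_td; have := ancestor_lt d t u lt_td.
move=> /(vertex_at d t _ lt_td)[v Ev].
suff [p [path_p leaf_p E]] : exists p : seq (vertex d),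
  [/\ path (@child d) v p, leaf (last v p) & stem d u t.+1 = [set w in v :: p]].
  by exists v, p.
elim: t lt_td v Ev => [|t IH] lt_td v Ev.
  exists [::]; split; rewrite //= /leaf ?Ev //.
  rewrite divn1 in Ev; rewrite (stem1 d u v Ev).
  by apply/setP => w; rewrite !inE.
have lt_t := ltnW lt_td.
have [x Ex] := vertex_at d t _ lt_t (ancestor_lt d t u lt_t).
have [p [path_p leaf_p E]] := IH lt_t x Ex.
exists (x :: p); split=> //=.
  rewrite path_p andbT /child /left_child /right_child Ev Ex !xpair_eqE /= divn_expS.
  by lia.
by rewrite (stemS d u t.+1 v Ev) E; apply/setP => w; rewrite !inE.
Qed.

(** * Diagonal covers as height functions *)

Lemma covering_diagonal_cover d (t : 'I_(2 ^ (d - 1)) -> nat) : 0 < d -> covering d t ->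
  diagonal_cover [set stem d u (t u) | u : 'I_(2 ^ (d - 1))] /\
  injective (fun u : 'I_(2 ^ (d - 1)) => stem d u (t u)).
Proof.
move=> hd t_cov; have t_pos u := covering_gt0 d t u hd t_cov.
have [t_le t_ex t_uniq] := t_cov.
have stem_disj (u u' : 'I_(2 ^ (d - 1))) (v : vertex d) : 
    v \in stem d u (t u) -> v \in stem d u' (t u') -> u = u'.
  have [i [j [Ev _ _]]] := vertexP d v.
  rewrite !(mem_stem d _ _ v i j Ev) => /andP[tu /eqP uj] /andP[tu' /eqP uj'].
  by apply: (t_uniq i) => //; rewrite uj uj'.
have leaf_stem (u : 'I_(2 ^ (d - 1))) : exists v, v \in stem d u (t u).
  have [v Ev] := vertex_at d 0 u hd (ltn_ord u).
  by exists v; rewrite (mem_stem d u _ v 0 u Ev) t_pos divn1 eqxx.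
(* Injectivity gives every cover [2 ^ (d - 1)] diagonals and allows sums over it to be reindexed by
   leaves. *)
split=> //; last first.
  move=> u u' /= E; have [v vu] := leaf_stem u.
  by apply: (stem_disj _ _ v); rewrite // -E.
split; last by move=> D /imsetP[u _ ->]; apply: stem_diagonal; rewrite t_pos t_le.
apply/and3P; split.
- rewrite eqEsubset subsetT; apply/subsetP => v _; apply/bigcupP.
  have [i [j [Ev lt_i lt_j]]] := vertexP d v.
  have [u uj tu] := t_ex i j lt_i lt_j.
  exists (stem d u (t u)); first exact: imset_f.
  by rewrite (mem_stem d u _ v i j Ev) tu uj eqxx.
- apply/trivIsetP => _ _ /imsetP[u _ ->] /imsetP[u' _ ->] neq_uu'.
  apply/pred0P => v /=; apply: contraNF neq_uu' => /andP[vu vu'].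
  by rewrite (stem_disj u u' v).
- by apply/imsetP => -[u _ E]; have [v] := leaf_stem u; rewrite -E inE.
Qed.

(** Each block is a stem and contains exactly one leaf; the height of [u] is read off the block
    containing leaf [u]. *)
Lemma diagonal_cover_covering d (P : {set {set vertex d}}) :
  0 < d -> diagonal_cover P ->
  exists2 t, covering d t & P = [set stem d u (t u) | u : 'I_(2 ^ (d - 1))].
Proof.
move=> hd [/and3P[/eqP cover_P /trivIsetP triv_P _] diag_P].
have leaf_ex (u : 'I_(2 ^ (d - 1))) := vertex_at d 0 u hd (ltn_ord u).
have leaf_in (v : vertex d) u s (lt_s : 0 < s) : val v = (1, u.+1) -> v \in stem d u s.
  by move=> Ev; rewrite (mem_stem d u s v 0 u Ev) lt_s divn1 eqxx.
have block_eq (D D' : {set vertex d}) v :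
    D \in P -> D' \in P -> v \in D -> v \in D' -> D = D'.
  move=> PD PD' vD vD'; apply/eqP; apply: contraT => neq.
  by have /pred0P/(_ v) := triv_P D D' PD PD' neq; rewrite /= vD vD'.
have /fin_all_exists[t t_prop] (u : 'I_(2 ^ (d - 1))) :
    exists s, (0 < s <= d) && (stem d u s \in P).
  have [v Ev] := leaf_ex u; have : v \in cover P by rewrite cover_P.
  move=> /bigcupP[D PD vD]; have [u' [s s_d ED]] := diagonal_stem d D (diag_P D PD).
  move: vD; rewrite ED (mem_stem d u' s v 0 u Ev) divn1 => /andP[_ /eqP/val_inj uu'].
  by exists s; rewrite -uu' -ED s_d.
have {t_prop} [t_pos t_le t_P] : [/\ forall u, 0 < t u, forall u, t u <= d
    & forall u : 'I_(2 ^ (d - 1)), stem d u (t u) \in P].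
  by split=> u; have /andP[/andP[]] := t_prop u.
have PE D : D \in P -> exists u : 'I_(2 ^ (d - 1)), D = stem d u (t u).
  move=> PD; have [u [s /andP[s_pos _] ED]] := diagonal_stem d D (diag_P D PD).
  have [v Ev] := leaf_ex u; exists u; apply: (block_eq _ _ v) => //.
    by rewrite ED leaf_in.
  exact: leaf_in.
exists t.
  split=> // [i j lt_i lt_j|i u u' eq_i tu tu'].
    have [v Ev] := vertex_at d i j lt_i lt_j.
    have : v \in cover P by rewrite cover_P.
    move=> /bigcupP[D /PE[u ->]]; rewrite (mem_stem d u _ v i j Ev) => /andP[tu /eqP uj].
    by exists u.
  have lt_i : i < d := leq_trans tu (t_le u).
  have [v Ev] := vertex_at d i _ lt_i (ancestor_lt d i u lt_i).
  have E : stem d u (t u) = stem d u' (t u').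
    apply: (block_eq _ _ v) => //.
      by rewrite (mem_stem d _ _ v i _ Ev) tu eqxx.
    by rewrite (mem_stem d _ _ v i _ Ev) tu' eq_i eqxx.
  have [w Ew] := leaf_ex u.
  have := leaf_in w u _ (t_pos u) Ew; rewrite E (mem_stem d _ _ w 0 _ Ew) divn1.
  by case/andP=> _ /eqP/val_inj.
apply/setP => D; apply/idP/imsetP => [/PE[u ->]|[u _ ->]] //.
by exists u.
Qed.

(** * The run of the algorithm *)

Lemma map_pmap_insub (d : nat) (T : Type) (F : vertex d -> T) (G : nat * nat -> T) cs :
  {subset cs <= tree_coords d} -> (forall v, val v \in cs -> F v = G (val v)) ->
  map F (pmap insub cs) = map G cs.
Proof.
elim: cs => //= c cs IH sub_cs FG.
have mem_c : c \in tree_coords d by apply: sub_cs; rewrite mem_head.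
rewrite insubT /= FG ?mem_head // IH // => [c' mem_c'|v mem_v].
  by apply: sub_cs; rewrite in_cons mem_c' orbT.
by apply: FG; rewrite in_cons mem_v orbT.
Qed.

(** Listed in leaf order, so that an index found by the algorithm is a leaf. *)
Definition stems (d : nat) (t : 'I_(2 ^ (d - 1)) -> nat) : seq {set vertex d} :=
  [seq stem d u (t u) | u : 'I_(2 ^ (d - 1)) <- enum 'I_(2 ^ (d - 1))].

Lemma greedy_initE d : 0 < d -> greedy_init d = stems d (fun=> 1).
Proof.
move=> hd; have sub : {subset layer_coords d 1 <= tree_coords d}.
  move=> c /mapP[j]; rewrite mem_iota => j_in ->.
  by rewrite mem_tree_coords /=; lia.
rewrite /greedy_init /layer (map_pmap_insub d _ _ (fun c => stem d c.2.-1 1)) //.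
  rewrite -map_comp (iotaDl 1 0) -map_comp -val_enum_ord -map_comp.
  by apply: eq_map => u /=.
move=> v /mapP[j]; rewrite mem_iota => j_in Ev.
by rewrite Ev (stem1 d j.-1 v) // Ev /= prednK //; lia.
Qed.

Lemma find_stems d (t : 'I_(2 ^ (d - 1)) -> nat) u p :
  (forall v : 'I_(2 ^ (d - 1)), p (stem d v (t v)) = (v == u)) ->
  find p (stems d t) = u.
Proof.
move=> pE; rewrite /stems find_map (eq_find (a2 := pred1 u)) //.
exact: index_enum_ord.
Qed.

Lemma nth_stems d (t : 'I_(2 ^ (d - 1)) -> nat) (u : 'I_(2 ^ (d - 1))) :
  nth set0 (stems d t) u = stem d u (t u).
Proof. by rewrite (nth_map u) ?size_enum_ord // nth_ord_enum. Qed.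

Lemma set_nth_stems d (t t' : 'I_(2 ^ (d - 1)) -> nat) (u : 'I_(2 ^ (d - 1))) :
  (forall v, v != u -> t' v = t v) ->
  set_nth set0 (stems d t) u (stem d u (t' u)) = stems d t'.
Proof.
move=> tE; have size_stems s : size (stems d s) = 2 ^ (d - 1).
  by rewrite size_map size_enum_ord.
apply: (eq_from_nth (x0 := set0)) => [|k].
  by rewrite size_set_nth !size_stems; apply/maxn_idPr.
rewrite size_set_nth size_stems (maxn_idPr _) // => lt_k.
rewrite nth_set_nth /=; case: eqP => [->|/eqP neq_ku]; first by rewrite nth_stems.
by rewrite !(nth_stems d _ (Ordinal lt_k)) tE.
Qed.

(* Position [j'] of layer [i'] has been treated by the algorithm once all layers
   below [i] and the first [j] positions of layer [i] have been. *)
Definition treated (i j i' j' : nat) : bool := (i' < i) || (i' == i) && (j' < j).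

(** The loop invariant: the conditions of [covering] relative to the treated vertices, and the
    greedy choices made so far. *)
Definition greedy_state (d : nat) (m : {mset vertex d}) (i j : nat)
    (g : seq {set vertex d}) : Prop :=
  exists t : 'I_(2 ^ (d - 1)) -> nat,
  [/\ g = stems d t,
      greedy_heights _ (fun u k => weight m (stem d u k)) t,
      forall (u : 'I_(2 ^ (d - 1))) i', i' < t u ->
        (i' < d) && treated i j i' (u %/ 2 ^ i'),
      forall i' j', i' < d -> j' < 2 ^ (d - i'.+1) -> treated i j i' j' ->
        exists2 u : 'I_(2 ^ (d - 1)), u %/ 2 ^ i' = j' & i' < t u &
      forall i' (u u' : 'I_(2 ^ (d - 1))), u %/ 2 ^ i' = u' %/ 2 ^ i' ->
        i' < t u -> i' < t u' -> u = u'].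

(** Both children of [v] are treated and [v] is not, so the diagonals through them end there. Hence
    the full weights that the algorithm compares are those that [greedy_heights] asks about. *)
Lemma greedy_stepP d (m : {mset vertex d}) i j g (v : vertex d) :
  i.+1 < d -> j < 2 ^ (d - i.+2) -> val v = (i.+2, j.+1) ->
  greedy_state d m i.+1 j g -> greedy_state d m i.+1 j.+1 (greedy_step m g v).
Proof.
move=> lt_i lt_j Ev [t [-> t_greedy t_treated t_ex t_uniq]].
set A := (fun u k => weight m (stem d u k)) in t_greedy *.
have lt_i' : i < d by lia.
have find_child b (p : pred {set vertex d}) (w : vertex d) :
    b < 2 -> val w = (i.+1, (2 * j + b).+1) ->
    (forall D : {set vertex d}, p D = (w \in D)) ->
    exists y : 'I_(2 ^ (d - 1)),
      [/\ find p (stems d t) = y, y %/ 2 ^ i = 2 * j + b & t y = i.+1].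
  move=> lt_b Ew pE.
  have lt_jb : 2 * j + b < 2 ^ (d - i.+1).
    by have -> : d - i.+1 = (d - i.+2).+1; [lia | rewrite expnS; lia].
  have [|y yj ty] := t_ex i _ lt_i' lt_jb; first by rewrite /treated ltnSn.
  exists y; split=> //.
    apply: find_stems => u; rewrite pE (mem_stem d u _ w i _ Ew).
    apply/andP/eqP => [[tu /eqP uj]|-> //]; last by rewrite ty yj eqxx.
    by apply: (t_uniq i) => //; rewrite uj yj.
  (* The next ancestor of [y] is the untreated position [j], so the height cannot exceed [i.+1]. *)
  have := t_treated y i.+1; rewrite /treated divn_expS yj.
  by lia.
have [wl El] := vertex_at d i (2 * j) lt_i' ltac:(
  have -> : d - i.+1 = (d - i.+2).+1; [lia | rewrite expnS; lia]).
have [wr Er] := vertex_at d i (2 * j).+1 lt_i' ltac:(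
  have -> : d - i.+1 = (d - i.+2).+1; [lia | rewrite expnS; lia]).
have exists_val (w : vertex d) c : val w = c -> forall D : {set vertex d},
    [exists u in D, val u == c] = (w \in D).
  move=> <- D; apply/exists_inP/idP => [[u uD /eqP/val_inj <-] //|wD].
  by exists w.
have [y [find_y yj ty]] := find_child 0
  (fun D : {set vertex d} => [exists u in D, left_child v u]) wl isT
  ltac:(by rewrite addn0) ltac:(move=> D; rewrite /left_child; apply: exists_val;
    rewrite Ev El /=; congr pair; lia).
have [z [find_z zj tz]] := find_child 1
  (fun D : {set vertex d} => [exists u in D, right_child v u]) wr isT
  ltac:(by rewrite addn1) ltac:(move=> D; rewrite /right_child; apply: exists_val;
    rewrite Ev Er /=; congr pair; lia).
(* [x] is the leaf whose diagonal is extended; the bound by the minimum serves both outcomes of the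
   test, ties included. *)
have [x [xj tx x_min x_step]] : exists x : 'I_(2 ^ (d - 1)),
  [/\ x %/ 2 ^ i.+1 = j, t x = i.+1, A x i.+1 <= minn (A y i.+1) (A z i.+1)
    & greedy_step m (stems d t) v =
      set_nth set0 (stems d t) x (v |: nth set0 (stems d t) x)].
  rewrite /greedy_step find_y find_z !nth_stems ty tz -/(A y i.+1) -/(A z i.+1).
  case: ltnP => le_yz; [exists y | exists z]; split; rewrite ?nth_stems ?divn_expS //.
  - by rewrite yj; lia.
  - by rewrite zj; lia.
pose t' (u : 'I_(2 ^ (d - 1))) := if u == x then i.+2 else t u.
have t'P (u : 'I_(2 ^ (d - 1))) k : k < t' u -> (k < t u) \/ (u = x /\ k = i.+1).
  rewrite /t'; case: eqP => [->|_]; last by left.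
  by rewrite ltnS leq_eqVlt tx => /orP[/eqP ->|]; [right | left].
have t_le u k : k < t u -> k < t' u.
  by rewrite /t'; case: eqP => // ->; rewrite tx; lia.
exists t'; split.
- rewrite x_step nth_stems tx -stemS ?Ev ?xj //.
  rewrite -(set_nth_stems d t t' x) => [|u /negbTE neq]; rewrite /t' ?neq //.
  by rewrite eqxx.
- move=> k u u' eq_uu' tu /t'P[tu'|[_ Ek]]; last first.
    have [tu1|[_]] := t'P _ _ tu; last by lia.
    by have := t_treated _ _ tu1; rewrite /treated; lia.
  have [tu1|[Eu [Ek]]] := t'P _ _ tu; first exact: t_greedy.
  rewrite {u}Eu {k}Ek in eq_uu' tu tu' *; apply: leq_trans x_min _.
  (* By uniqueness, a diagonal reaching a child of [v] is that of [y] or of [z]. *)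
  have : u' %/ 2 ^ i = 2 * j \/ u' %/ 2 ^ i = 2 * j + 1.
    by move: eq_uu'; rewrite xj divn_expS; lia.
  case=> u'j; [rewrite (t_uniq i u' y) ?geq_minl|rewrite (t_uniq i u' z) ?geq_minr] => //.
  + by rewrite u'j yj addn0.
  + by rewrite ty.
  + by rewrite u'j zj.
  + by rewrite tz.
- move=> u k /t'P[/t_treated|[-> ->]]; rewrite /treated; first by lia.
  by rewrite xj lt_i eqxx ltnSn orbT.
- move=> k b lt_k lt_b; have [E|neq] := eqVneq (k, b) (i.+1, j).
    by case: E => -> -> _; exists x; rewrite // /t' eqxx.
  move=> tr; have [|u uj tu] := t_ex k b lt_k lt_b; last first.
    by exists u; last exact: t_le.
  by move: tr neq; rewrite /treated xpair_eqE; lia.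
- have no_old (u : 'I_(2 ^ (d - 1))) : u %/ 2 ^ i.+1 = j -> t u <= i.+1.
    move=> uj; rewrite leqNgt; apply/negP => /t_treated.
    by rewrite /treated uj; lia.
  move=> k u u' eq_uu' /t'P[tu|[Eu Ek]] /t'P[tu'|[Eu' Ek']]; last by rewrite Eu Eu'.
  + exact: (t_uniq k).
  + by have := no_old u; rewrite -Ek' eq_uu' Eu' Ek' xj => /(_ erefl); lia.
  + by have := no_old u'; rewrite -Ek -eq_uu' Eu Ek xj => /(_ erefl); lia.
Qed.

Lemma greedy_layer d (m : {mset vertex d}) i g n :
  i.+1 < d -> n <= 2 ^ (d - i.+2) -> greedy_state d m i.+1 0 g ->
  greedy_state d m i.+1 n
    (foldl (greedy_step m) g (pmap insub [seq (i.+2, j) | j <- iota 1 n])).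
Proof.
move=> lt_i + state_g; elim: n => [|n IH] // lt_n.
rewrite -[X in iota _ X]addn1 iotaD map_cat pmap_cat foldl_cat /= add1n.
have [v Ev] := vertex_at d i.+1 n lt_i lt_n.
rewrite -Ev valK /=; apply: greedy_stepP => //.
by apply: IH; apply: ltnW.
Qed.

Lemma greedy_state_next d (m : {mset vertex d}) i g :
  greedy_state d m i (2 ^ (d - i.+1)) g -> i < d -> greedy_state d m i.+1 0 g.
Proof.
move=> [t [Eg t_greedy t_treated t_ex t_uniq]] lt_i; exists t; split=> //.
- by move=> u k /t_treated; rewrite /treated; lia.
- move=> k j lt_k lt_j; rewrite /treated ltn0 andbF orbF ltnS leq_eqVlt => tr.
  apply: t_ex => //; rewrite /treated.
  by case/orP: tr => [/eqP Ek|->] //; rewrite -Ek eqxx lt_j orbT.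
Qed.

(** With [d] layers done every vertex is treated, and the invariant yields [covering]. *)
Lemma greedy_covering d (m : {mset vertex d}) : 0 < d ->
  exists t, [/\ covering d t, greedy_heights _ (fun u k => weight m (stem d u k)) t
    & greedy_output m = [set stem d u (t u) | u : 'I_(2 ^ (d - 1))]].
Proof.
move=> hd; suff [t [Eg t_greedy t_treated t_ex t_uniq]] : greedy_state d m d 0 (greedy m).
  exists t; split=> //; last first.
    apply/setP => D; rewrite /greedy_output inE Eg.
    apply/mapP/imsetP => [[u _ ->]|[u _ ->]]; exists u => //.
    by rewrite mem_enum.
  split=> // [u|i j lt_i lt_j]; last by apply: t_ex; rewrite // /treated lt_i.
  rewrite leqNgt; apply/negP => /t_treated.
  by rewrite ltnn.
suff state n : n < d -> greedy_state d m n.+1 0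
    (foldl (greedy_step m) (greedy_init d) (flatten [seq layer d i | i <- iota 2 n])).
  by have := state d.-1; rewrite prednK //; apply.
elim: n => [_|n IH lt_n].
  rewrite greedy_initE //=; exists (fun=> 1); split=> //.
  - by move=> u [|k] // _; rewrite hd.
  - move=> [|k] j _ lt_j; last by rewrite /treated ltn0 andbF.
    by move=> _; exists (Ordinal lt_j); rewrite //= divn1.
  - by move=> [|k] u u' //; rewrite !divn1 => /val_inj.
rewrite -[X in iota _ X]addn1 iotaD map_cat flatten_cat foldl_cat /= cats0.
apply: greedy_state_next => //; apply: greedy_layer => //.
by apply: IH; apply: ltnW.
Qed.

(** * Counting losses *)

Lemma card_element d (m : {mset vertex d}) (D : {set vertex d}) :
  #|[set e : element m | tag e \in D]| = weight m D.
Proof.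
rewrite -sum1dep_card /weight.
transitivity (\sum_(v in D) \sum_(e < m v) 1); last first.
  by apply: eq_bigr => v _; rewrite sum1_card card_ord.
by rewrite sig_big_dep; apply: eq_bigl => e; rewrite andbT.
Qed.

Lemma card_elements d (m : {mset vertex d}) :
  #|element m| = weight m [set: vertex d].
Proof. by rewrite -card_element -cardsT; apply: eq_card => e; rewrite !inE. Qed.

(** Complementation turns a loss into its set of survivors, of size [n - l] for total weight [n];
    the loss empties [D] exactly when no survivor lies in [D]. *)
Lemma card_emptying d (m : {mset vertex d}) l (D : {set vertex d}) :
  l <= weight m [set: vertex d] ->
  #|[set S in losses m l | ~~ nonempty_after D S]| =
  'C(weight m [set: vertex d] - weight m D, weight m [set: vertex d] - l).
Proof.
move=> le_l; rewrite -(card_imset _ (inv_inj (@setCK _))).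
rewrite -card_elements in le_l *; rewrite -card_element.
rewrite -[X in X - #|[set e | _]|]cardsT -cardsDS ?subsetT // setTD -cards_draws.
apply: eq_card => S; rewrite !inE -[S]setCK mem_imset; last exact: inv_inj (@setCK _).
rewrite !inE setCS setCK andbC; congr (_ && _); last first.
  by have := cardsC S; have := max_card (~: S); lia.
apply/existsPn/subsetP => [empty e|sub e]; last first.
  by apply/negP => /andP[/negP nS eD]; apply: nS; apply: sub; rewrite inE.
by rewrite inE => eD; have := empty e; rewrite eD andbT negbK.
Qed.

(** For each diagonal, emptying and other losses add up to all losses. With equally many diagonals
    the denominators agree, so fewer emptying losses mean a larger average. *)
Lemma average_nonempty_le d (m : {mset vertex d}) l (P Q : {set {set vertex d}}) :
  l <= weight m [set: vertex d] -> #|P| = #|Q| ->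
  let h w := 'C(weight m [set: vertex d] - w, weight m [set: vertex d] - l) in
  \sum_(D in P) h (weight m D) <= \sum_(D in Q) h (weight m D) ->
  (average_nonempty m l Q <= average_nonempty m l P)%R.
Proof.
move=> le_l eqPQ h le_h.
have total (X : {set {set vertex d}}) :
    \sum_(D in X) #|[set S in losses m l | nonempty_after D S]| +
    \sum_(D in X) h (weight m D) = #|X| * #|losses m l|.
  rewrite -big_split /= -sum_nat_const; apply: eq_bigr => D _.
  rewrite /h -card_emptying // -(cardsID [set S | nonempty_after D S] (losses m l)).
  by congr (_ + _); apply: eq_card => S; rewrite !inE // andbC.
rewrite /average_nonempty eqPQ; apply: Num.Theory.ler_wpM2r.
  by rewrite Num.Theory.invr_ge0 Num.Theory.ler0n.
rewrite /prob_nonempty -!GRing.mulr_suml; apply: Num.Theory.ler_wpM2r.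
  by rewrite Num.Theory.invr_ge0 Num.Theory.ler0n.
rewrite -!GRing.natr_sum Num.Theory.ler_nat.
by have := total P; have := total Q; rewrite eqPQ; lia.
Qed.

Theorem theorem32 (d : nat) (hd : 1 <= d) (m : {mset vertex d}) :
  diagonal_cover (greedy_output m) /\
  (forall l : nat, l <= weight m [set: vertex d] ->
     principal_cover m l (greedy_output m)).
Proof.
have [t [t_cov t_greedy ->]] := greedy_covering d m hd.
have [cover_t inj_t] := covering_diagonal_cover d t hd t_cov.
split=> // l le_l; split=> // Q cover_Q.
have [t' t'_cov ->] := diagonal_cover_covering d Q hd cover_Q.
have [_ inj_t'] := covering_diagonal_cover d t' hd t'_cov.
apply: average_nonempty_le => //; first by rewrite !card_imset.
rewrite !big_imset /=; [|exact: in2W..].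
(* [W k j] is the weight of position [j] in layer [k], both counted from 0, and is 0 outside the
   tree. *)
pose W k j := \sum_(v : vertex d | val v == (k.+1, j.+1)) m v.
exact: (greedy_heights_optimal d _ _ W) (weight_stemS d m)
  (convex_bin_sub _ _) t_cov t_greedy t'_cov.
Qed.
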